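(* For a real number $a$ and a nonnegative integer $n$ let $(a)_n=a(a+1)(a+2)\cdots(a+n-1)$ (with $(a)_0=1$). (a) Let $p$ be a prime with $p\equiv 1\pmod 4$ and define $$s_n=64^n\frac{\left(\frac14\right)_n^2}{(1)_n^2}.$$ Then for every positive integer $n$, $s_{np}\equiv s_n \pmod{p^2}$. (b) Let $p$ be a prime with $p\equiv 1\pmod 6$ and define $$t_n=108^n\frac{\left(\frac16\right)_n\left(\frac13\right)_n}{(1)_n^2}.$$ Then for every positive integer $n$, $t_{np}\equiv t_n\pmod{p^2}$.
   Context: The numbers $s_n$ and $t_n$ are rational numbers (in fact integers). For rational numbers $x,y$ whose denominators are prime to $p$, $x\equiv y\pmod{p^k}$ means that $x-y$, written in lowest terms, has numerator divisible by $p^k$. *)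

(* Defs.v *)
From mathcomp Require Import all_boot all_order all_algebra.

Set Implicit Arguments.
Unset Strict Implicit.
Unset Printing Implicit Defensive.

Import Order.TTheory GRing.Theory Num.Theory.
Local Open Scope ring_scope.

Definition pochhammer (R : realFieldType) (a : R) (n : nat) : R :=
  \prod_(i < n) (a + i%:R).

Definition s (n : nat) : rat :=
  64%:R ^+ n * (pochhammer (1 / 4%:R) n ^+ 2 / pochhammer 1 n ^+ 2).

Definition t (n : nat) : rat :=
  108%:R ^+ n *
  ((pochhammer (1 / 6%:R) n * pochhammer (1 / 3%:R) n) / pochhammer 1 n ^+ 2).

(* The congruence x = y (mod p ^ k) is only meaningful when p is prime to both
   denominators, so this is part of the definition. [numq] and [denq] refer to
   the fraction in lowest terms. *)
Definition eqmod_rat (p k : nat) (x y : rat) : Prop :=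
  [/\ coprimez (denq x) p%:Z,
      coprimez (denq y) p%:Z
    & ((p ^ k)%N%:Z %| numq (x - y))%Z].

(* Main.v *)
(* Let [G d c] be the product of the [d * k + c] prime to [p], for [k < p].
   Splitting off the multiples of [p] in [\prod_(i < n * p) (d * i + 1)] gives
   [s (n * p) / s n = (4^(p-1) G(4,1)^2 / G(1,1)^2)^n] and
   [t (n * p) / t n = (6^(p-1) G(6,1) G(3,1) / G(1,1)^2)^n] modulo [p^2]; both
   are [1] modulo [p^2]. Indeed [G d c] only depends on [c] modulo [p], because
   the inverses of the nonzero residues sum to [0] modulo [p]; hence
   [\prod_(j < e) G (d * e) (d * j + c) = G d c ^ e], and with
   [G d (d - c) = G d c] and [G (e * d) (e * c) = e^(p-1) G d c] this gives
   the needed values. *)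

Require Import Defs.
From mathcomp Require Import all_boot all_order all_algebra.
From mathcomp Require Import zify ring.

Import GRing.Theory.

(** * Regrouping of finite products and congruences as equalities in $\mathbb{Z}/q$ *)

Lemma big_ord_mul (R : Type) (idx : R) (op : Monoid.law idx) (n k : nat)
    (F : nat -> R) :
  \big[op/idx]_(i < n * k) F i =
  \big[op/idx]_(i < n) \big[op/idx]_(j < k) F (k * i + j).
Proof.
elim: n => [|n IHn]; first by rewrite !big_ord0.
rewrite big_ord_recr /= -IHn mulSnr big_split_ord /= [k * n]mulnC.
by congr (op _ _).
Qed.

Lemma natr_Zp_eq (q m n : nat) :
  1 < q -> (m%:R = n%:R :> 'Z_q)%R <-> m = n %[mod q].
Proof.
move=> q_gt1; split=> [eq_mn|eq_mn].
  by rewrite -(val_Zp_nat q_gt1 m) -(val_Zp_nat q_gt1 n) eq_mn.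
by rewrite -(Zp_nat_mod q_gt1 m) -(Zp_nat_mod q_gt1 n) eq_mn.
Qed.

(** * Products of the terms prime to $p$ in an arithmetic progression, modulo $p^2$ *)

Definition punit_prod (p d c : nat) : nat :=
  \prod_(k < p | ~~ (p %| d * k + c)) (d * k + c).

Section PunitProd.

Variable p : nat.
Hypotheses (p_prime : prime p) (p_gt2 : 2 < p).

Let p_gt0 : 0 < p := prime_gt0 p_prime.
Let R := 'Z_(p ^ 2).
Let G := punit_prod p.

Let p2_gt1 : 1 < p ^ 2.
Proof. by rewrite -{1}[1](exp1n 2) ltn_exp2r // prime_gt1. Qed.

Lemma natr_sqr_eq0 : (p%:R * p%:R = 0 :> R)%R.
Proof. by rewrite -natrM mulnn; apply: pchar_Zp. Qed.

Lemma natr_unit_Zp2 (a : nat) : ~~ (p %| a) -> (a%:R : R)%R \is a GRing.unit.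
Proof. by move=> pNa; rewrite unitZpE // coprimeXl // prime_coprime. Qed.

Lemma affine_mod_inj (d c : nat) (k l : 'I_p) :
  ~~ (p %| d) -> d * k + c = d * l + c %[mod p] -> k = l.
Proof.
move=> pNd /eqP; rewrite eqn_modDr => eq_kl; apply: val_inj.
wlog le_lk : k l eq_kl / l <= k.
  by case/orP: (leq_total l k) => le /(_ _ _ _ le) ->; rewrite // eq_sym.
move: eq_kl; rewrite eqn_mod_dvd ?leq_mul // -mulnBr Euclid_dvdM //.
rewrite (negPf pNd) /= => /dvdn_leq le_p; apply/eqP.
rewrite eqn_leq le_lk andbT -subn_eq0; case: posnP => // /le_p.
by rewrite leqNgt (leq_ltn_trans (leq_subr _ _) (ltn_ord k)).
Qed.

(** Since $p\nmid d$, the map $k\mapsto dk+c$ permutes the residues modulo $p$. *)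
Lemma big_affine (T : Type) (idx : T) (op : Monoid.com_law idx) (d c : nat)
    (f : nat -> T) :
  ~~ (p %| d) ->
  \big[op/idx]_(k < p | ~~ (p %| d * k + c)) f ((d * k + c) %% p) =
  \big[op/idx]_(r < p | (r : nat) != 0) f r.
Proof.
move=> pNd; pose h (k : 'I_p) := Ordinal (ltn_pmod (d * k + c) p_gt0).
have h_inj : injective h by move=> k l /(congr1 val) /(affine_mod_inj _ _ _ _ pNd).
by rewrite [RHS](reindex_inj h_inj).
Qed.

Lemma big_nonzero_nat (T : Type) (idx : T) (op : Monoid.com_law idx)
    (f : nat -> T) :
  \big[op/idx]_(r < p | (r : nat) != 0) f r = \big[op/idx]_(1 <= r < p) f r.
Proof.
rewrite -(big_mkord (fun r => r != 0)) big_ltn_cond //= big_nat_cond.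
rewrite [RHS]big_nat_cond; apply: eq_bigl => i; by case: i.
Qed.

Lemma card_punit (d c : nat) :
  ~~ (p %| d) -> #|[pred k : 'I_p | ~~ (p %| d * k + c)]| = p.-1.
Proof.
move=> pNd; rewrite -sum1_card (big_affine _ _ addn d c (fun=> 1)) //.
by rewrite (big_nonzero_nat _ _ addn (fun=> 1)) sum_nat_const_nat muln1 subn1.
Qed.

(** Modulo $p^2$, the term $p/a$ depends only on $a$ modulo $p$, so the sum becomes that of $p/r$
    for $0<r<p$. There $r$ and $p-r$ give opposite terms, so the sum is its own negative, and $2$ is
    a unit. *)
Lemma sum_inv_punit (d c : nat) :
  ~~ (p %| d) ->
  (p%:R * \sum_(k < p | ~~ (p %| d * k + c)%N) (d * k + c)%:R^-1 = 0 :> R)%R.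
Proof.
move=> pNd; rewrite mulr_sumr.
pose f r : R := (p%:R / r%:R)%R.
have fmod a : ~~ (p %| a) -> f (a %% p) = f a.
  move=> pNa; have pNr : ~~ (p %| a %% p) by rewrite /dvdn modn_mod.
  apply: (mulIr (natr_unit_Zp2 _ pNr)); rewrite /f mulrVK ?natr_unit_Zp2 //.
  apply: (mulIr (natr_unit_Zp2 _ pNa)); rewrite mulrAC mulrVK ?natr_unit_Zp2 //.
  rewrite [in LHS](divn_eq a p) natrD natrM mulrDr.
  by rewrite mulrCA natr_sqr_eq0 mulr0 add0r.
transitivity (\sum_(k < p | ~~ (p %| d * k + c)%N) f ((d * k + c) %% p)%N)%R.
  by apply: eq_bigr => k pNk; rewrite fmod.
rewrite (big_affine _ _ _ d c f) // big_nonzero_nat.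
set S := (X in X = _).
have S2 : (S = - S)%R.
  rewrite {1}/S big_nat_rev -sumrN /= add1n; apply: eq_big_nat => r /andP[r_gt0 r_lt].
  rewrite subSS.
  have pNr : ~~ (p %| r) by rewrite gtnNdvd.
  have pNpr : ~~ (p %| p - r) by rewrite gtnNdvd ?subn_gt0 // ltn_subrL r_gt0.
  apply: (mulIr (natr_unit_Zp2 _ pNr)); apply: (mulIr (natr_unit_Zp2 _ pNpr)).
  rewrite /f mulrAC mulrVK ?natr_unit_Zp2 // mulNr mulrVK ?natr_unit_Zp2 //.
  by rewrite mulNr natrB 1?ltnW // mulrBr natr_sqr_eq0 sub0r opprK.
have two_unit : (2%:R : R)%R \is a GRing.unit by rewrite natr_unit_Zp2 // gtnNdvd.
by apply: (mulrI two_unit); rewrite mulr0 mulr2n mulrDl mul1r {1}S2 addNr.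
Qed.

Lemma prod_1Dp (I : finType) (P : pred I) (z : I -> R) :
  (\prod_(i | P i) (1 + p%:R * z i) = 1 + p%:R * \sum_(i | P i) z i)%R.
Proof.
elim/big_rec2: _ => [|i x y _ ->]; first by rewrite mulr0 addr0.
rewrite mulrDr mulr1 mulrDl mul1r mulrACA natr_sqr_eq0 mul0r addr0.
by rewrite mulrDr addrA.
Qed.

(* To first order in [p], translating the factors by [p * x] multiplies the
   product by [1 + p x S], where [S] is the sum of the inverses of the factors,
   and [p S = 0] modulo [p ^ 2]. *)
Lemma prod_punit_shift (d c : nat) (x : R) :
  ~~ (p %| d) ->
  (\prod_(k < p | ~~ (p %| d * k + c)%N) ((d * k + c)%:R + p%:R * x) =
   (G d c)%:R)%R.
Proof.
move=> pNd; rewrite /G /punit_prod natr_prod.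
transitivity (\prod_(k < p | ~~ (p %| d * k + c)%N)
   ((d * k + c)%:R * (1 + p%:R * (x * (d * k + c)%:R^-1) : R)))%R.
  apply: eq_bigr => k pNk; rewrite mulrDr mulr1; congr (_ + _)%R.
  by rewrite [in RHS]mulrCA [X in (_ = _ * X)%R]mulrCA divrr ?natr_unit_Zp2 // mulr1.
rewrite big_split /= prod_1Dp -mulr_sumr mulrCA sum_inv_punit //.
by rewrite mulr0 addr0 mulr1.
Qed.

Lemma punit_prodDp (d c x : nat) :
  ~~ (p %| d) -> ((G d (c + p * x))%:R = (G d c)%:R :> R)%R.
Proof.
move=> pNd; rewrite -(prod_punit_shift d c (x%:R)%R pNd) {1}/G /punit_prod natr_prod.
apply: eq_big => [k|k _]; first by rewrite addnA dvdn_addl // dvdn_mulr.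
by rewrite addnA natrD natrM.
Qed.

(** The reversal $k\mapsto p-1-k$ turns $dk+(d-c)$ into $pd-(dk+c)$. The shift by $pd$ does not
    change the product modulo $p^2$, and the $p-1$ signs cancel because $p$ is odd. *)
Lemma punit_prod_sub (d c : nat) :
  ~~ (p %| d) -> c <= d -> ((G d (d - c))%:R = (G d c)%:R :> R)%R.
Proof.
move=> pNd le_cd.
have rev (k : 'I_p) : d * rev_ord k + (d - c) = p * d - (d * k + c).
  have := ltn_ord k; rewrite /=; nia.
have le (k : 'I_p) : d * k + c <= p * d by have := ltn_ord k; nia.
rewrite {1}/G /punit_prod natr_prod (reindex_inj rev_ord_inj).
transitivity (\prod_(k < p | ~~ (p %| d * k + c)%N)
    - ((d * k + c)%:R + p%:R * (- d%:R) : R))%R.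
  apply: eq_big => [k|k _].
    by rewrite rev dvdn_subr ?le // dvdn_mulr.
  by rewrite rev natrB ?le // natrM mulrN opprB.
rewrite prodrN prod_punit_shift // (eq_card (B := [pred k : 'I_p | ~~ (p %| d * k + c)])) //.
rewrite card_punit // -signr_odd.
suff -> : odd p.-1 = false by rewrite mul1r.
have := even_prime p_prime; lia.
Qed.

Lemma punit_prod_scale (e d c : nat) :
  ~~ (p %| e) -> ~~ (p %| d) -> G (e * d) (e * c) = e ^ p.-1 * G d c.
Proof.
move=> pNe pNd; rewrite -(card_punit d c pNd) -prod_nat_const -big_split /=.
apply: eq_big => [k|k _]; rewrite -mulnA -mulnDr //.
by rewrite Euclid_dvdM // (negPf pNe).
Qed.

(* Both sides are products over the same [e * p] terms [d * i + c], grouped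
   by the residue of [i] modulo [e] and by blocks of length [p]. *)
Lemma punit_prod_distr (e d c : nat) :
  ~~ (p %| d) ->
  (\prod_(j < e) (G (d * e) (d * j + c))%:R = (G d c)%:R ^+ e :> R)%R.
Proof.
move=> pNd.
(* Replacing the multiples of $p$ by $1$ removes the side condition, so the product can be regrouped
   freely. *)
pose F i := if p %| d * i + c then 1 else d * i + c.
have GF c' b : G c' b = \prod_(k < p) (if p %| c' * k + b then 1 else c' * k + b).
  by rewrite /G /punit_prod big_mkcond; apply: eq_bigr => k _; case: (p %| _).
transitivity ((\prod_(i < p * e) F i)%:R : R)%R.
  rewrite -natr_prod big_ord_mul exchange_big /=; congr (_%:R)%R.
  apply: eq_bigr => j _; rewrite GF; apply: eq_bigr => k _.
  by rewrite /F mulnDr mulnA addnA.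
rewrite mulnC big_ord_mul natr_prod -[in RHS](card_ord e) -prodr_const.
(* The $j$-th block of length $p$ is the progression with $c$ shifted by $p\cdot dj$. *)
apply: eq_bigr => j _; rewrite -(punit_prodDp d c (d * j)) // GF.
congr (_%:R)%R; apply: eq_bigr => k _; rewrite /F.
by have -> : d * (p * j + k) + c = d * k + (c + p * (d * j)) by ring.
Qed.

Lemma punit_prod_unit (d c : nat) : ~~ (p %| G d c).
Proof.
rewrite /G /punit_prod; elim/big_ind: _ => // [|x y pNx pNy].
  by rewrite Euclid_dvd1.
by rewrite Euclid_dvdM // negb_or pNx.
Qed.

Let pN1 : ~~ (p %| 1). Proof. by rewrite Euclid_dvd1. Qed.
Let pN2 : ~~ (p %| 2). Proof. by rewrite gtnNdvd. Qed.
Let unitG d c : ((G d c)%:R : R)%R \is a GRing.unit.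
Proof. by rewrite natr_unit_Zp2 // punit_prod_unit. Qed.

(** From $G(2,1)G(2,2)=G(1,1)^2$ and $G(2,2)=2^{p-1}G(1,1)$ comes $2^{p-1}G(2,1)=G(1,1)$. Square
    this and use $G(2,1)^2=G(4,1)G(4,3)=G(4,1)^2$. *)
Lemma punit_prod_4_1 :
  (4%:R ^+ p.-1 * (G 4 1)%:R ^+ 2 = (G 1 1)%:R ^+ 2 :> R)%R.
Proof.
have E1 : ((G 2 1)%:R * (G 2 2)%:R = (G 1 1)%:R ^+ 2 :> R)%R.
  by rewrite -(punit_prod_distr 2) // !big_ord_recl big_ord0 mulr1.
have E2 : ((G 4 1)%:R * (G 4 3)%:R = (G 2 1)%:R ^+ 2 :> R)%R.
  by rewrite -(punit_prod_distr 2) // !big_ord_recl big_ord0 mulr1.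
have E1' : (2%:R ^+ p.-1 * (G 2 1)%:R = (G 1 1)%:R :> R)%R.
  apply: (mulIr (unitG 1 1)); rewrite -expr2 -E1.
  by rewrite (punit_prod_scale 2 1 1) // natrM natrX mulrAC mulrC.
have pN4 : ~~ (p %| 4) by rewrite (Euclid_dvdM 2 2) // negb_or pN2.
rewrite (punit_prod_sub 4 1) // in E2.
by rewrite -E1' expr2 E2 -[4]/(2 * 2) natrM !exprMn; ring.
Qed.

(** Distribution over $3$, with $G(3,3)=3^{p-1}G(1,1)$ and $G(3,2)=G(3,1)$, gives
    $3^{p-1}G(3,1)^2=G(1,1)^2$. Distribution over $2$, with $G(6,4)=2^{p-1}G(3,2)$, gives
    $2^{p-1}G(6,1)=G(3,1)$. *)
Lemma punit_prod_6_1 :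
  ~~ (p %| 3) ->
  (6%:R ^+ p.-1 * ((G 6 1)%:R * (G 3 1)%:R) = (G 1 1)%:R ^+ 2 :> R)%R.
Proof.
move=> pN3.
have E1 : ((G 3 1)%:R * ((G 3 2)%:R * (G 3 3)%:R) = (G 1 1)%:R ^+ 3 :> R)%R.
  by rewrite -(punit_prod_distr 3) // !big_ord_recl big_ord0 mulr1.
have E2 : ((G 6 1)%:R * (G 6 4)%:R = (G 3 1)%:R ^+ 2 :> R)%R.
  by rewrite -(punit_prod_distr 2) // !big_ord_recl big_ord0 mulr1.
have E32 := punit_prod_sub 3 1 pN3 isT.
have E1' : (3%:R ^+ p.-1 * (G 3 1)%:R ^+ 2 = (G 1 1)%:R ^+ 2 :> R)%R.
  apply: (mulIr (unitG 1 1)); rewrite -exprSr -E1 E32.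
  by rewrite (punit_prod_scale 3 1 1) // natrM natrX; ring.
have E2' : (2%:R ^+ p.-1 * (G 6 1)%:R = (G 3 1)%:R :> R)%R.
  apply: (mulIr (unitG 3 1)); rewrite -expr2 -E2.
  by rewrite (punit_prod_scale 2 3 2) // natrM natrX E32; ring.
by rewrite -E1' expr2 -{2}E2' -[6]/(2 * 3) natrM !exprMn; ring.
Qed.

End PunitProd.

(** * The sequences $s_n$ and $t_n$ through products of arithmetic progressions *)

Definition arith_prod (d n : nat) : nat := \prod_(i < n) (d * i + 1).

(** The denominator is $n!$; for $d>0$ the value is $(-d)^n\binom{-1/d}{n}$. *)
Definition arith_binom (d n : nat) : rat :=
  ((arith_prod d n)%:R / (arith_prod 1 n)%:R)%R.

Lemma arith_prod_gt0 (d n : nat) : 0 < arith_prod d n.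
Proof. by rewrite prodn_gt0 // => i; rewrite addn1. Qed.

Lemma arith_prod_neq0 (d n : nat) : ((arith_prod d n)%:R != 0 :> rat)%R.
Proof. by rewrite Num.Theory.pnatr_eq0 -lt0n arith_prod_gt0. Qed.

Lemma pochhammer_arith_prod (R : realFieldType) (d n : nat) :
  0 < d -> (pochhammer (1 / d%:R) n = (arith_prod d n)%:R / d%:R ^+ n :> R)%R.
Proof.
move=> d_gt0; have d_neq0 : (d%:R != 0 :> R)%R by rewrite Num.Theory.pnatr_eq0 -lt0n.
rewrite /pochhammer /arith_prod natr_prod -[in (d%:R ^+ n)%R](card_ord n).
rewrite -prodr_const -prodf_div; apply: eq_bigr => i _.
by rewrite natrD natrM; field.
Qed.

Lemma pochhammer1_arith_prod (R : realFieldType) (n : nat) :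
  (pochhammer 1 n = (arith_prod 1 n)%:R :> R)%R.
Proof.
rewrite /pochhammer /arith_prod natr_prod; apply: eq_bigr => i _.
by rewrite mul1n natrD addrC.
Qed.

Lemma sE (n : nat) : (s n = 4%:R ^+ n * arith_binom 4 n ^+ 2)%R.
Proof.
have ne := arith_prod_neq0 1 n.
have ne4 : ((4%:R : rat) ^+ n != 0)%R by rewrite expf_neq0.
rewrite /s pochhammer1_arith_prod pochhammer_arith_prod // /arith_binom.
(* Each of the two factors $(1/4)_n$ absorbs one $4^n$, which leaves $4^n$. *)
rewrite -[64]/(4 * 4 * 4) !natrM !exprMn; field.
by rewrite ne ne4.
Qed.

Lemma tE (n : nat) : (t n = 6%:R ^+ n * (arith_binom 6 n * arith_binom 3 n))%R.
Proof.
have ne := arith_prod_neq0 1 n.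
have ne6 : ((6%:R : rat) ^+ n != 0)%R by rewrite expf_neq0.
have ne3 : ((3%:R : rat) ^+ n != 0)%R by rewrite expf_neq0.
rewrite /t pochhammer1_arith_prod !pochhammer_arith_prod // /arith_binom.
(* Here $(1/6)_n$ absorbs $6^n$ and $(1/3)_n$ absorbs $3^n$, which leaves $6^n$. *)
rewrite -[108]/(6 * 6 * 3) !natrM !exprMn; field.
by rewrite ne ne6 ne3.
Qed.

(** * Fractions with denominator prime to $p$, and congruences between them *)

Definition p_integral (p : nat) (x : rat) : Prop :=
  exists a b : nat, ~~ (p %| b) /\ (x = a%:R / b%:R)%R.

Lemma p_integralM (p : nat) (x y : rat) :
  prime p -> p_integral p x -> p_integral p y -> p_integral p (x * y)%R.
Proof.
move=> p_prime [a [b [pNb ->]]] [a' [b' [pNb' ->]]].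
exists (a * a'), (b * b'); rewrite Euclid_dvdM // negb_or pNb; split=> //.
by rewrite !natrM invfM mulrACA.
Qed.

Lemma p_integral_nat (p a : nat) : prime p -> p_integral p (a%:R)%R.
Proof. by move=> p_prime; exists a, 1; rewrite Euclid_dvd1 // divr1. Qed.

(** Cross-multiplying with the reduced form, a prime $p$ dividing [denq x] but not $b$ would also
    divide [numq x]. *)
Lemma coprime_denq_frac (p : nat) (a b : int) :
  prime p -> ~~ (p %| `|b|) -> coprimez (denq (a%:~R / b%:~R)) p%:Z.
Proof.
move=> p_prime pNb; set x := (_ / _)%R.
have b_neq0 : (b != 0)%R by apply: contraNneq pNb => ->; rewrite dvdn0.
have eqx : (numq x * b = a * denq x)%R.
  apply/eqP; rewrite -(eqr_int rat) !rmorphM /= numqE /x; apply/eqP.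
  by field; rewrite intr_eq0.
rewrite coprimezE coprime_sym prime_coprime //; apply: contra pNb => pd.
have: p %| `|numq x| * `|b| by rewrite -abszM eqx abszM dvdn_mull.
rewrite Euclid_dvdM // => /orP[pn|//].
have := coprime_num_den x; rewrite /coprime => /eqP g1.
by have := dvdn_gcd p `|numq x| `|denq x|; rewrite g1 pn pd Euclid_dvd1.
Qed.

Lemma dvd_numq_frac (p k : nat) (a b : int) :
  prime p -> ~~ (p %| `|b|) -> ((p ^ k)%N%:Z %| a)%Z ->
  ((p ^ k)%N%:Z %| numq (a%:~R / b%:~R))%Z.
Proof.
move=> p_prime pNb pka; set x := (_ / _)%R.
have b_neq0 : (b != 0)%R by apply: contraNneq pNb => ->; rewrite dvdn0.
have eqx : (numq x * b = a * denq x)%R.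
  apply/eqP; rewrite -(eqr_int rat) !rmorphM /= numqE /x; apply/eqP.
  by field; rewrite intr_eq0.
have cop : coprimez (p ^ k)%N%:Z b by rewrite coprimezE /= coprimeXl // prime_coprime.
by rewrite -(Gauss_dvdzl _ cop) eqx dvdz_mulr.
Qed.

(** For $x=a/b$ the difference is $a(m-n)/(bn)$, so the rational congruence reduces to $m\equiv n$
    in the natural numbers. *)
Lemma eqmod_rat_mul (p : nat) (x : rat) (m n : nat) :
  prime p -> p_integral p x -> ~~ (p %| n) -> m = n %[mod p ^ 2] ->
  eqmod_rat p 2 (x * (m%:R / n%:R))%R x.
Proof.
move=> p_prime [a [b [pNb ->]]] pNn eq_mn.
have natz c : (c%:R = c%:Z%:~R :> rat)%R by [].
have nz c : ~~ (p %| c) -> (c%:R != 0 :> rat)%R.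
  by move=> pNc; rewrite Num.Theory.pnatr_eq0; apply: contraNneq pNc => ->; rewrite dvdn0.
split.
- rewrite mulrACA -invfM -!natrM !natz.
  by apply: coprime_denq_frac; rewrite // Euclid_dvdM // negb_or pNb.
- by rewrite !natz; apply: coprime_denq_frac.
have -> : (a%:R / b%:R * (m%:R / n%:R) - a%:R / b%:R =
  (a%:Z * (m%:Z - n%:Z))%:~R / (b * n)%N%:Z%:~R :> rat)%R.
  rewrite rmorphM rmorphB /= -!natz natrM; field.
  by rewrite !nz.
apply: dvd_numq_frac => //; first by rewrite /= Euclid_dvdM // negb_or pNb.
apply: dvdz_mull; rewrite -eqz_mod_dvd.
by apply/eqP; rewrite !modz_nat eq_mn.
Qed.

(** * Splitting off the multiples of $p$, and $p$-integrality *)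

Lemma mod1_ndvd (p d : nat) : prime p -> p = 1 %[mod d] -> ~~ (p %| d).
Proof.
move=> p_prime /eqP; rewrite eqn_mod_dvd ?prime_gt0 // => d_dvd.
have p_gt1 := prime_gt1 p_prime.
have : ~~ (p %| p - 1) by rewrite gtnNdvd //; lia.
by apply: contra => /dvdn_trans; apply.
Qed.

(* As [p = d * m + 1], the multiples of [p] among the [d * i + 1] with
   [i < n * p] are the [p * (d * j + 1)] with [j < n], at [i = p * j + m]. *)
Lemma arith_prod_mulp (p d n : nat) :
  prime p -> p = 1 %[mod d] ->
  arith_prod d (n * p) =
  p ^ n * arith_prod d n * \prod_(j < n) punit_prod p d (1 + p * (d * j)).
Proof.
move=> p_prime p_mod; have pNd := mod1_ndvd p d p_prime p_mod.
have p_gt0 := prime_gt0 p_prime.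
rewrite /arith_prod (big_ord_mul _ _ muln n p (fun i => d * i + 1)).
rewrite -[in p ^ n](card_ord n) -prod_nat_const -!big_split /=.
apply: eq_bigr => j _.
have [m def_p] : exists m, p = d * m + 1.
  move/eqP: p_mod; rewrite eqn_mod_dvd // => /dvdnP[m def_m].
  by exists m; rewrite mulnC -def_m subnK.
have m_lt : m < p.
  have : d != 0 by apply: contraNneq pNd => ->; rewrite dvdn0.
  move: def_p; clear; nia.
have term_m : d * (p * j + m) + 1 = p * (d * j + 1) by rewrite mulnDr -addnA -def_p; ring.
rewrite (bigD1 (Ordinal m_lt)) //= term_m; congr (_ * _).
have termE (k : nat) : d * k + (1 + p * (d * j)) = d * (p * j + k) + 1 by ring.
apply: eq_big => [k|k _]; last by rewrite termE.
rewrite termE; apply/idP/idP; last first.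
  by apply: contra => /eqP ->; rewrite /= term_m dvdn_mulr.
apply: contra => /eqP p_dvd; apply/eqP.
(* Injectivity of $k\mapsto dk+c$ modulo $p$ shows that $m$ is the only index of the block giving a
   multiple of $p$. *)
apply: (affine_mod_inj p p_prime d (p * (d * j) + 1) _ _ pNd).
have shift (l : nat) : d * l + (p * (d * j) + 1) = d * (p * j + l) + 1 by ring.
by rewrite !shift p_dvd term_m modnMr.
Qed.

Lemma arith_prodD (d m n : nat) :
  arith_prod d (m + n) = arith_prod d m * \prod_(i < n) (d * (m + i) + 1).
Proof. by rewrite /arith_prod big_split_ord. Qed.

Lemma arith_binomD (d m n : nat) :
  (arith_binom d (m + n) = arith_binom d m *
     ((\prod_(i < n) (d * (m + i) + 1))%:R / (\prod_(i < n) (m + i).+1)%:R))%R.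
Proof.
rewrite /arith_binom !arith_prodD !natrM mulrACA -invfM; congr (_ / (_ * _%:R))%R.
by apply: eq_bigr => i _; rewrite mul1n addn1.
Qed.

(** Numerator and denominator contain the same power $p^n$, which cancels; $n!$ is the case $d=1$,
    where the condition on $p$ is trivial. *)
Lemma arith_binom_mulp (p d n : nat) :
  prime p -> p = 1 %[mod d] ->
  (arith_binom d (n * p) = arith_binom d n *
    ((\prod_(j < n) punit_prod p d (1 + p * (d * j)))%N%:R /
     (\prod_(j < n) punit_prod p 1 (1 + p * (1 * j)))%N%:R))%R.
Proof.
move=> p_prime p_mod; rewrite /arith_binom !arith_prod_mulp ?modn1 //.
have pn_neq0 : ((p ^ n)%N%:R != 0 :> rat)%R.
  by rewrite Num.Theory.pnatr_eq0 -lt0n expn_gt0 prime_gt0.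
by rewrite !natrM -mulf_div -mulf_div divff // mul1r.
Qed.

Lemma prod_ndvd (p : nat) (I : finType) (F : I -> nat) :
  prime p -> (forall i, ~~ (p %| F i)) -> ~~ (p %| \prod_i F i).
Proof.
move=> p_prime pNF; elim/big_ind: _ => // [|x y pNx pNy].
  by rewrite Euclid_dvd1.
by rewrite Euclid_dvdM // negb_or pNx.
Qed.

(* Write [n = q * p + r] with [r < p]: the quotient from [q] to [q * p] and
   that from [q * p] to [q * p + r] both have denominators prime to [p]. *)
Lemma arith_binom_p_integral (p d n : nat) :
  prime p -> p = 1 %[mod d] -> p_integral p (arith_binom d n).
Proof.
move=> p_prime p_mod; elim/ltn_ind: n => n IHn.
have [->|n_gt0] := posnP n.
  by exists 1, 1; rewrite Euclid_dvd1 // /arith_binom /arith_prod !big_ord0.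
rewrite (divn_eq n p) arith_binomD arith_binom_mulp //.
apply: p_integralM => //; first apply: p_integralM => //.
- by apply: IHn; rewrite ltn_Pdiv ?prime_gt1.
- do 2 eexists; split; last by [].
  by apply: prod_ndvd => // j; apply: punit_prod_unit.
do 2 eexists; split; last by [].
(* Each factor is a multiple of $p$ plus $i+1$, with $0<i+1\le n \bmod p<p$. *)
apply: prod_ndvd => // i; rewrite -addnS dvdn_addr ?dvdn_mull //.
by rewrite gtnNdvd // (leq_ltn_trans (ltn_ord i)) // ltn_pmod ?prime_gt0.
Qed.

(** * The quotients modulo $p^2$ and the two congruences *)

Lemma prod_punit_shifts (p d n : nat) :
  prime p -> 2 < p -> ~~ (p %| d) ->
  ((\prod_(j < n) punit_prod p d (1 + p * (d * j)))%N%:R =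
   (punit_prod p d 1)%:R ^+ n :> 'Z_(p ^ 2))%R.
Proof.
move=> p_prime p_gt2 pNd; rewrite natr_prod -[in RHS](card_ord n) -prodr_const.
by apply: eq_bigr => j _; rewrite punit_prodDp.
Qed.

Theorem theorem1p1 :
  (forall p : nat, prime p -> p = 1 %[mod 4] ->
     forall n : nat, 0 < n -> eqmod_rat p 2 (s (n * p)) (s n)) /\
  (forall p : nat, prime p -> p = 1 %[mod 6] ->
     forall n : nat, 0 < n -> eqmod_rat p 2 (t (n * p)) (t n)).
Proof.
have exp_split (a p n : nat) : prime p ->
    (a%:R ^+ (n * p) = a%:R ^+ n * (a ^ (n * p.-1))%:R :> rat)%R.
  by move=> p_prime; rewrite natrX -exprD -mulnS prednK ?prime_gt0.
split=> p p_prime p_mod n _.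
  have p_gt2 : 2 < p by have := prime_gt1 p_prime; case: p p_mod {p_prime} => [|[|[|]]].
  have pN4 := mod1_ndvd p 4 p_prime p_mod.
  rewrite !sE arith_binom_mulp // exp_split //.
  set A := \prod_(j < n) _; set B := \prod_(j < n) _.
  (* This isolates $s_n$ times a quotient of natural numbers prime to $p$ in the denominator, the
     form needed by [eqmod_rat_mul]. *)
  have -> : (4%:R ^+ n * (4 ^ (n * p.-1))%:R * (arith_binom 4 n * (A%:R / B%:R)) ^+ 2
     = 4%:R ^+ n * arith_binom 4 n ^+ 2 *
       ((4 ^ (n * p.-1) * A ^ 2)%N%:R / (B ^ 2)%N%:R))%R.
    by rewrite natrM !(natrX _ _ 2) exprMn mulrACA (expr_div_n A%:R%R) !mulrA.
  have pNB : ~~ (p %| B) by apply: prod_ndvd => // j; apply: punit_prod_unit.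
  apply: eqmod_rat_mul => //.
  - rewrite -natrX expr2; apply: p_integralM => //; first exact: p_integral_nat.
    by apply: p_integralM => //; apply: arith_binom_p_integral.
  - by rewrite Euclid_dvdX // negb_and pNB.
  apply/natr_Zp_eq; first by rewrite -{1}[1](exp1n 2) ltn_exp2r // prime_gt1.
  rewrite natrM !natrX !prod_punit_shifts // ?Euclid_dvd1 //.
  (* Both sides are gathered into $n$-th powers, so that the case $n=1$ suffices. *)
  rewrite mulnC exprM -!exprM ![n * 2]mulnC !exprM -exprMn.
  by rewrite punit_prod_4_1.
have p_gt2 : 2 < p by have := prime_gt1 p_prime; case: p p_mod {p_prime} => [|[|[|]]].
have p_mod3 : p = 1 %[mod 3] by rewrite -(modn_dvdm p (isT : 3 %| 6)) p_mod.
have pN3 := mod1_ndvd p 3 p_prime p_mod3.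
have pN6 := mod1_ndvd p 6 p_prime p_mod.
rewrite !tE !arith_binom_mulp // exp_split //.
set A := \prod_(j < n) _; set B := \prod_(j < n) _; set C := \prod_(j < n) _.
have -> : (6%:R ^+ n * (6 ^ (n * p.-1))%:R *
     (arith_binom 6 n * (A%:R / B%:R) * (arith_binom 3 n * (C%:R / B%:R)))
   = 6%:R ^+ n * (arith_binom 6 n * arith_binom 3 n) *
     ((6 ^ (n * p.-1) * (A * C))%N%:R / (B ^ 2)%N%:R))%R.
  by rewrite !natrM [(arith_binom 6 n * _ * _)%R]mulrACA (mulf_div A%:R%R) mulrACA !mulrA.
have pNB : ~~ (p %| B) by apply: prod_ndvd => // j; apply: punit_prod_unit.
apply: eqmod_rat_mul => //.
- rewrite -natrX; apply: p_integralM => //; first exact: p_integral_nat.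
  by apply: p_integralM => //; apply: arith_binom_p_integral.
- by rewrite Euclid_dvdX // negb_and pNB.
apply/natr_Zp_eq; first by rewrite -{1}[1](exp1n 2) ltn_exp2r // prime_gt1.
rewrite !natrM !natrX !prod_punit_shifts // ?Euclid_dvd1 //.
(* Again both sides become $n$-th powers of the two sides of [punit_prod_6_1]. *)
rewrite mulnC exprM -!exprMn -expr2.
by rewrite punit_prod_6_1.
Qed.
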